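(* Let $k\ge2$, let $v\in S_k$ be fixed and let $0<\theta<1$. Then there exist $0<\kappa<1$ and $r_0>0$ such that, for all $z\in\mathbb{C}$ with $|z|\le r_0$, the operator $T_{v,z}$ is bounded on $\mathcal{B}_{\theta,\kappa}$. Moreover, by shrinking $\kappa$ if necessary one may take $r_0\ge1$, so in particular $T_{v,1}$ is bounded on $\mathcal{B}_{\theta,\kappa}$.
   Context: Permutations are written in one-line notation; $S_n$ is the set of permutations of $\{1,\dots,n\}$ ($S_0$ contains only the empty permutation); $\sim$ denotes order-isomorphism of sequences. A permutation avoids $v\in S_k$ if no length-$k$ subsequence of it is order-isomorphic to $v$; $\mathrm{Av}(v)$ is the set of all permutations avoiding $v$. Right insertion: for $\pi\in S_n$, $r\in\{1,\dots,n+1\}$, $\mathrm{ins}(\pi,r)\in S_{n+1}$ is obtained by increasing by $1$ every value of $\pi$ that is $\ge r$ and appending the value $r$ at position $n+1$. Frontier: for $\pi\in S_n$ avoiding $v$, a $(k-1)$-partial occurrence of $v$ in $\pi$ is a tuple $i_1<\dots<i_{k-1}$ of positions with $(\pi_{i_1},\dots,\pi_{i_{k-1}})\sim(v_1,\dots,v_{k-1})$. Its forbidden rank set $J_\pi(i_1,\dots,i_{k-1})$ is the set of $r\in\{1,\dots,n+1\}$ such that $\pi'=\mathrm{ins}(\pi,r)$ satisfies $(\pi'_{i_1},\dots,\pi'_{i_{k-1}},\pi'_{n+1})\sim(v_1,\dots,v_k)$. The frontier $\mathcal{F}_v(\pi)$ is the set of all $(k-1)$-partial occurrences with nonempty forbidden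 rank set, and $\mathrm{Forb}_v(\pi)=\bigcup_{p\in\mathcal{F}_v(\pi)}J_\pi(p)$. State space: $\mathsf{X}_v$ is the set of pairs $x=(\pi,\mathcal{F}_v(\pi))$ with $\pi\in\mathrm{Av}(v)$; $m(x)=|\mathcal{F}_v(\pi)|$, $s(x)=|\pi|$ (length), $A_v(x)=\{1,\dots,s(x)+1\}\setminus\mathrm{Forb}_v(\pi)$, and for $r\in A_v(x)$, $\Phi_v(x,r)=(\pi',\mathcal{F}_v(\pi'))\in\mathsf{X}_v$ with $\pi'=\mathrm{ins}(\pi,r)$. For $0<\theta,\kappa<1$, $\mathcal{B}_{\theta,\kappa}$ is the Banach space of $f:\mathsf{X}_v\to\mathbb{C}$ with $\|f\|_{\theta,\kappa}:=\sup_{x}\theta^{-m(x)}\kappa^{-s(x)^2}|f(x)|<\infty$, and $(T_{v,z}f)(x):=\sum_{r\in A_v(x)}z\,f(\Phi_v(x,r))$. *)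

(* Defs.v *)
From HB Require Import structures.
From mathcomp Require Import all_boot all_order all_algebra all_fingroup.
From mathcomp Require Import complex.
From mathcomp Require Import all_classical all_reals ereal.

Set Implicit Arguments.
Unset Strict Implicit.
Unset Printing Implicit Defensive.

Import Order.TTheory GRing.Theory Num.Theory.

(* Permutations of {1, ..., n} are elements of 'S_n, i.e. permutations of
   {0, ..., n - 1}: positions, values and insertion ranks are all shifted
   down by one. *)

Section Patterns.

Definition order_iso (s t : seq nat) : bool :=
  (size s == size t) &&
  [forall i : 'I_(size s), forall j : 'I_(size s),
    (nth 0 s i < nth 0 s j) == (nth 0 t i < nth 0 t j)].

Definition increasing n k (i : k.-tuple 'I_n) : bool :=
  sorted ltn [seq val j | j <- i].

Definition values n (p : 'S_n) (i : seq 'I_n) : seq nat :=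
  [seq val (p j) | j <- i].

Definition one_line n (p : 'S_n) : seq nat := values p (enum 'I_n).

Definition occurrence k (v : 'S_k) n (p : 'S_n) (i : k.-tuple 'I_n) : bool :=
  increasing i && order_iso (values p i) (one_line v).

Definition avoids k (v : 'S_k) n (p : 'S_n) : bool :=
  ~~ [exists i : k.-tuple 'I_n, occurrence v p i].

(* [lift_perm ord_max r p] sends the last position to r and any earlier
   position j to [bump r (p j)], which is (p j).+1 if r <= p j and p j
   otherwise. *)
Definition ins n (p : 'S_n) (r : 'I_n.+1) : 'S_n.+1 := lift_perm ord_max r p.

Definition partial_occurrence k (v : 'S_k) n (p : 'S_n)
    (i : k.-1.-tuple 'I_n) : bool :=
  increasing i && order_iso (values p i) (take k.-1 (one_line v)).

Definition append_last n (i : seq 'I_n) : seq 'I_n.+1 :=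
  rcons [seq widen_ord (leqnSn n) j | j <- i] ord_max.

Definition forbidden_ranks k (v : 'S_k) n (p : 'S_n) (i : k.-1.-tuple 'I_n) :
    {set 'I_n.+1} :=
  [set r | order_iso (values (ins p r) (append_last i)) (one_line v)].

Definition frontier k (v : 'S_k) n (p : 'S_n) : {set k.-1.-tuple 'I_n} :=
  [set i | partial_occurrence v p i & forbidden_ranks v p i != finset.set0].

Definition Forb k (v : 'S_k) n (p : 'S_n) : {set 'I_n.+1} :=
  (\bigcup_(i in frontier v p) forbidden_ranks v p i)%SET.

End Patterns.

Section OrderIso.

Lemma order_isoP (s t : seq nat) :
  reflect (size s = size t /\
    forall i j, i < size s -> j < size s ->
      (nth 0 s i < nth 0 s j) = (nth 0 t i < nth 0 t j))
    (order_iso s t).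
Proof.
apply: (iffP andP) => [[/eqP sz /forallP st]|[sz st]].
  split=> // i j lti ltj.
  by have /forallP/(_ (Ordinal ltj))/eqP := st (Ordinal lti).
split; first exact/eqP.
by apply/forallP => i; apply/forallP => j; apply/eqP/st.
Qed.

Lemma order_iso_mono (f : nat -> nat) (s t : seq nat) :
    {mono f : x y / x < y} ->
  order_iso [seq f x | x <- s] t = order_iso s t.
Proof.
move=> fm; apply/order_isoP/order_isoP => -[sz st]; split=> //.
- by rewrite -sz size_map.
- by move=> i j lti ltj; rewrite -st ?size_map// !(nth_map 0)// fm.
- by rewrite size_map.
- move=> i j; rewrite size_map => lti ltj.
  by rewrite !(nth_map 0)// fm st.
Qed.

Lemma order_iso_take (s t : seq nat) n :
  order_iso s t -> order_iso (take n s) (take n t).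
Proof.
move=> /order_isoP[sz st]; apply/order_isoP; split.
  by rewrite !size_take sz.
move=> i j; rewrite !size_take_min !leq_min => /andP[i1 i2] /andP[j1 j2].
by rewrite !nth_take// st.
Qed.

Lemma ltn_bump r : {mono bump r : x y / x < y}.
Proof. by move=> x y; rewrite !ltnNge leq_bump2. Qed.

Lemma values_ins n (p : 'S_n) r (i : seq 'I_n) :
  values (ins p r) [seq widen_ord (leqnSn n) j | j <- i] =
  [seq bump r x | x <- values p i].
Proof.
rewrite /values -!map_comp; apply: eq_map => j /=.
have -> : widen_ord (leqnSn n) j = lift ord_max j.
  by apply: val_inj; rewrite /= /bump leqNgt ltn_ord.
by rewrite /ins lift_perm_lift.
Qed.

Lemma sorted_ltn_rcons (s : seq nat) x :
  sorted ltn (rcons s x) = all (ltn^~ x) s && sorted ltn s.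
Proof.
by rewrite !(sorted_pairwise ltn_trans) -cats1 pairwise_cat allrel1r /= andbT.
Qed.

Lemma unwiden n (s : seq 'I_n.+1) :
  ord_max \notin s -> exists s', s = [seq widen_ord (leqnSn n) j | j <- s'].
Proof.
elim: s => [_|x s IH]; first by exists [::].
rewrite inE negb_or => /andP[xn /IH[s' ->]].
have ltx : x < n.
  by rewrite ltn_neqAle -ltnS ltn_ord andbT eq_sym; exact: xn.
by exists (Ordinal ltx :: s'); congr cons; exact: val_inj.
Qed.

Lemma increasing_last n (s : seq 'I_n.+1) : sorted ltn [seq val j | j <- s] ->
  exists s' : seq 'I_n,
    s = [seq widen_ord (leqnSn n) j | j <- s'] \/ s = append_last s'.
Proof.
case/lastP: s => [_|s x]; first by exists [::]; left.
rewrite map_rcons sorted_ltn_rcons.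
move=> /andP[/allP sx _].
have lesx y : y \in s -> y < x by move=> ys; apply: sx; exact: map_f.
have : ord_max \notin s.
  by apply/negP => /lesx; rewrite ltnNge -ltnS ltn_ord.
case: (eqVneq x ord_max) => [-> /unwiden[s' ->]|xn ms].
  by exists s'; right.
have /unwiden[s' ->] : ord_max \notin rcons s x.
  by rewrite mem_rcons inE negb_or eq_sym xn.
by exists s'; left.
Qed.

Lemma sorted_widen n (s : seq 'I_n) :
  [seq val j | j <- [seq widen_ord (leqnSn n) j | j <- s]] =
  [seq val j | j <- s].
Proof. by rewrite -map_comp. Qed.

End OrderIso.

Lemma avoids_ins k (v : 'S_k) n (p : 'S_n) (r : 'I_n.+1) :
  avoids v p -> r \notin Forb v p -> avoids v (ins p r).
Proof.
move=> vp; apply: contra => /existsP[[i szi]] /andP[]; rewrite /increasing /=.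
move=> si oi; have [s [defi|defi]] := increasing_last si.
  rewrite {}defi in si szi oi.
  have szs : size s == k by rewrite size_map in szi.
  case/negP: vp; apply/existsP; exists (Tuple szs); apply/andP; split.
    by rewrite sorted_widen in si.
  rewrite values_ins order_iso_mono in oi; [exact: oi|exact: ltn_bump].
rewrite {}defi in si szi oi.
have szs : size s == k.-1.
  by rewrite -(eqP szi) size_rcons size_map.
have rs : r \in forbidden_ranks v p (Tuple szs) by rewrite inE.
apply/bigcupP; exists (Tuple szs) => //.
rewrite inE; apply/andP; split; last by apply/set0Pn; exists r.
apply/andP; split.
  rewrite map_rcons sorted_ltn_rcons in si.
  by case/andP: si => _; rewrite sorted_widen.
have := order_iso_take k.-1 oi.
rewrite /values map_rcons -cats1 take_cat !size_map (eqP szs) ltnn subnn take0.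
rewrite cats0 -/(values _ _) values_ins order_iso_mono//; exact: ltn_bump.
Qed.

Local Open Scope classical_set_scope.
Local Open Scope ring_scope.

Section Transfer.
Context (k : nat) (v : 'S_k).

(* The pair (perm_of, frontier_of), together with its length. *)
Record state := State {
  length_of : nat;
  perm_of : 'S_length_of;
  frontier_of : {set k.-1.-tuple 'I_length_of};
  perm_of_avoids : avoids v perm_of;
  frontier_ofE : frontier_of = frontier v perm_of
}.

Definition frontier_size (x : state) : nat := #|frontier_of x|.

Definition allowed (x : state) : {set 'I_(length_of x).+1} :=
  ~: Forb v (perm_of x).

Lemma allowed_avoids (x : state) (r : {r | r \in allowed x}) :
  avoids v (ins (perm_of x) (val r)).
Proof.
by apply: avoids_ins (perm_of_avoids x) _; have := valP r; rewrite inE.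
Qed.

Definition step (x : state) (r : {r | r \in allowed x}) : state :=
  State (allowed_avoids r) erefl.

Context (R : realType).

Definition transfer (z : R[i]) (f : state -> R[i]^o) : state -> R[i]^o :=
  fun x => \sum_(r : {r | r \in allowed x}) z * f (step r).

Lemma transfer_is_linear z : linear (transfer z).
Proof.
move=> a f g; apply/funext => x.
transitivity (\sum_(r : {r | r \in allowed x}) z * (a * f (step r) + g (step r))).
  by [].
transitivity (a * transfer z f x + transfer z g x); last by [].
rewrite mulr_sumr -big_split/=; apply: eq_bigr => r _.
by rewrite mulrDr mulrCA.
Qed.

HB.instance Definition _ z :=
  GRing.isLinear.Build R[i] (state -> R[i]^o) (state -> R[i]^o) _
    (transfer z) (transfer_is_linear z).

(* The weighted sup norm, with value +oo outside the space. *)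
Definition wnorm (theta kappa : R) (f : state -> R[i]^o) : \bar R :=
  ereal_sup (range (fun x : state =>
    (theta ^- frontier_size x * kappa ^- (length_of x ^ 2)%N
       * Normc.normc (f x))%:E)).

Definition wspace (theta kappa : R) : set (state -> R[i]^o) :=
  [set f | wnorm theta kappa f < +oo]%E.

Definition bounded_operator (theta kappa : R)
    (T : {linear (state -> R[i]^o) -> (state -> R[i]^o)}) : Prop :=
  (forall f, wspace theta kappa f -> wspace theta kappa (T f)) /\
  exists C : R, forall f, wspace theta kappa f ->
    (wnorm theta kappa (T f) <= C%:E * wnorm theta kappa f)%E.

End Transfer.

Arguments transfer {k} v {R} z f.

(* Main.v *)
Require Import Defs.
From mathcomp Require Import all_boot all_order all_algebra all_fingroup.
From mathcomp Require Import complex.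
From mathcomp Require Import all_classical all_reals ereal.
From mathcomp Require Import zify.

Import Order.TTheory GRing.Theory Num.Theory.
Local Open Scope ring_scope.

(** Right insertion preserves the relative order of the values already present,
  so a partial occurrence with nonempty forbidden rank set remains one: the
  frontier never shrinks along a transition, and the factor
  [theta ^ (m(x') - m(x))] is at most 1. The at most [n + 1] transitions out of
  a state of length [n] each cost [kappa ^ ((n + 1)^2 - n^2)], and
  [(n + 1) kappa ^ (2n + 1) <= 1] as soon as [kappa <= 1/2]. *)

Lemma values_ins_append_last n (p : 'S_n) (r : 'I_n.+1) (i : seq 'I_n) :
  values (ins p r) (append_last i) =
  rcons [seq bump r x | x <- values p i] (val r).
Proof.
by rewrite -values_ins /values /append_last map_rcons /= /ins lift_perm_id.
Qed.

(* The two insertions commute up to a shift of the second rank, so inserting [r]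
   first changes the pattern formed with [r0] by a monotone map only. *)
Lemma bump_rcons_exchange (r r0 : nat) (s : seq nat) :
  rcons [seq bump (bump r r0) x | x <- [seq bump r x | x <- s]] (bump r r0) =
  [seq bump (r + (r0 < r))%N y | y <- rcons [seq bump r0 x | x <- s] r0].
Proof.
rewrite map_rcons -!map_comp; congr rcons; last by rewrite /bump; lia.
by apply: eq_map => x /=; rewrite /bump; lia.
Qed.

(** The new rank is [bump r r0]: the old one moved past the value [r] just placed. By the exchange
    identity the values at hand are only relabelled monotonically. *)
Lemma forbidden_ranks_ins {k} (v : 'S_k) n (p : 'S_n) (r r0 : 'I_n.+1)
    (i : k.-1.-tuple 'I_n) :
  r0 \in forbidden_ranks v p i ->
  lift (widen_ord (leqnSn n.+1) r) r0
    \in forbidden_ranks v (ins p r) (map_tuple (widen_ord (leqnSn n)) i).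
Proof.
rewrite !inE !values_ins_append_last values_ins /= bump_rcons_exchange.
by rewrite order_iso_mono//; exact: ltn_bump.
Qed.

Lemma frontier_ins {k} (v : 'S_k) n (p : 'S_n) (r : 'I_n.+1)
    (i : k.-1.-tuple 'I_n) :
  i \in frontier v p ->
  map_tuple (widen_ord (leqnSn n)) i \in frontier v (ins p r).
Proof.
rewrite !inE => /andP[/andP[inc_i iso_i] /set0Pn[r0 /(forbidden_ranks_ins _ _ _ r)]].
move=> r0'; apply/andP; split; last by apply/set0Pn; eexists; exact: r0'.
apply/andP; split; first by rewrite /increasing sorted_widen.
by rewrite values_ins order_iso_mono//; exact: ltn_bump.
Qed.

Lemma frontier_size_step {k} (v : 'S_k) (x : state v)
    (r : {r | r \in allowed x}) :
  (frontier_size x <= frontier_size (step r))%N.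
Proof.
rewrite /frontier_size /= frontier_ofE.
(* Widening positions embeds the old frontier into the new one, so cardinalities compare. *)
have inj_widen :
    injective (map_tuple (n := k.-1) (widen_ord (leqnSn (length_of x)))).
  move=> s t /(congr1 val) /= /inj_map st; apply/val_inj/st.
  by move=> a b /(congr1 val) ?; exact: val_inj.
rewrite -(card_imset _ inj_widen); apply/subset_leq_card/fintype.subsetP.
by move=> _ /imsetP[i xi ->]; exact: frontier_ins.
Qed.

Lemma normc_ge0 {R : rcfType} (x : R[i]) : 0 <= Normc.normc x.
Proof. by case: x => a b; exact: sqrtr_ge0. Qed.

Lemma ler_normc_sum {R : rcfType} {I : finType} (F : I -> R[i]) :
  Normc.normc (\sum_i F i) <= \sum_i Normc.normc (F i).
Proof.
elim/big_ind2: _ => [|x a y b xa yb|//]; first by rewrite Normc.normc0.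
by apply: le_trans (le_normcD _ _) _; exact: lerD.
Qed.

Lemma mulrn_expr_half_le1 {R : realFieldType} (kappa : R) n :
  0 <= kappa <= 2^-1 -> n.+1%:R * kappa ^+ n.*2.+1 <= 1.
Proof.
move=> /andP[k0 k2].
have kn : kappa ^+ n.*2.+1 <= 2^-1 ^+ n.*2.+1.
  by rewrite lerXn2r// nnegrE invr_ge0 ler0n.
apply: le_trans (ler_wpM2l (ler0n _ _) kn) _.
rewrite exprVn -natrX ler_pdivrMr ?ltr0n ?expn_gt0// mul1r ler_nat.
(* At [kappa = 1/2] the claim is [n + 1 <= 2^(2n+1)], obtained through [n < 2^n]. *)
apply: leq_trans (ltn_expl n (isT : (1 < 2)%N)) _.
by rewrite leq_exp2l//; lia.
Qed.

Section TransferBound.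
Context {R : realType} {k : nat} (v : 'S_k) {theta kappa : R}.
Hypotheses (theta01 : 0 < theta <= 1) (kappa_gt0 : 0 < kappa)
  (kappa_le : kappa <= 2^-1).

(** The reciprocal of the factor in [wnorm]: a norm bound [M] then reads [|f x| <= M * weight x]. *)
Let weight (x : state v) : R :=
  theta ^+ frontier_size x * kappa ^+ (length_of x ^ 2)%N.

Let weight_gt0 x : 0 < weight x.
Proof. by case/andP: theta01 => t0 _; rewrite mulr_gt0// exprn_gt0. Qed.

Lemma weight_step (x : state v) (r : {r | r \in allowed x}) :
  weight (step r) <= kappa ^+ (length_of x).*2.+1 * weight x.
Proof.
case/andP: theta01 => t0 t1; rewrite /weight mulrCA -exprD.
apply: ler_pM; rewrite ?exprn_ge0 ?(ltW t0) ?(ltW kappa_gt0)//.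
  by apply: ler_wiXn2l; rewrite ?(ltW t0)//; exact: frontier_size_step.
(* The exponents agree: [(n+1)^2 = (2n+1) + n^2]. *)
rewrite le_eqVlt; apply/orP; left; apply/eqP; congr (_ ^+ _) => /=; lia.
Qed.

Lemma wnormE (f : state v -> R[i]^o) :
  wnorm theta kappa f =
  ereal_sup (range (fun x => (Normc.normc (f x) / weight x)%:E)).
Proof.
rewrite /wnorm; congr ereal_sup; apply: eq_imagel => x _.
by rewrite /weight invfM mulrC.
Qed.

(** The gain [kappa^(2n+1)] of one step absorbs the number of summands, at most [n + 1], so the
    operator norm is at most [|z|]. *)
Lemma wnorm_transfer_le (z : R[i]) (f : state v -> R[i]^o) :
  wspace theta kappa f ->
  (wnorm theta kappa (transfer v z f)
     <= (Normc.normc z)%:E * wnorm theta kappa f)%E.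
Proof.
rewrite /wspace /= !wnormE => foo.
set S := ereal_sup _ in foo *.
apply/ereal_supP => _ [x _ <-].
have term y : ((Normc.normc (f y) / weight y)%:E <= S)%E.
  by apply: le_ereal_sup_tmp;
    exists (Normc.normc (f y) / weight y)%:E => //; exists y.
(* Membership in the space excludes [+oo]; the term at the state [x] under consideration excludes
   [-oo]. *)
have [M SM] : exists M : R, S = M%:E.
  by case: S foo term => [M| |] // _ => [_|/(_ x)]; [exists M|rewrite leeNy_eq].
rewrite SM -EFinM lee_fin ler_pdivrMr//.
have fM y : Normc.normc (f y) <= M * weight y.
  by have := term y; rewrite SM lee_fin ler_pdivrMr.
have M0 : 0 <= M.
  by have := le_trans (normc_ge0 _) (fM x); rewrite pmulr_lge0.
apply: le_trans (ler_normc_sum _) _.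
(* A bound on each summand that does not depend on the rank [r]. *)
pose c := Normc.normc z * M * (kappa ^+ (length_of x).*2.+1 * weight x).
have c0 : 0 <= c.
  by do 2![apply: mulr_ge0 => //]; rewrite ?normc_ge0 ?exprn_ge0 // ltW.
apply: (@le_trans _ _ (\sum_(r : {r | r \in allowed x}) c)).
  apply: ler_sum => r _; rewrite Normc.normcM /c -mulrA.
  apply: ler_wpM2l; first exact: normc_ge0.
  by apply: le_trans (fM _) _; apply: ler_wpM2l => //; exact: weight_step.
rewrite sumr_const.
have card_allowed : (#|{: {r | r \in allowed x}}| <= (length_of x).+1)%N.
  by rewrite card_sig -[leqRHS]card_ord max_card.
apply: le_trans (ler_wpMn2l c0 card_allowed) _.
rewrite -mulr_natl /c mulrCA [X in _ * X]mulrA.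
apply: ler_wpM2l; first by rewrite mulr_ge0 ?normc_ge0.
by rewrite ler_piMl ?mulrn_expr_half_le1 ?(ltW kappa_gt0)// ltW.
Qed.

Lemma transfer_bounded (z : R[i]) : bounded_operator theta kappa (transfer v z).
Proof.
split=> [f fw|]; last first.
  by exists (Normc.normc z) => f; exact: wnorm_transfer_le.
rewrite /wspace /=; apply: le_lt_trans (wnorm_transfer_le z f fw) _.
by rewrite lte_mul_pinfty// lee_fin normc_ge0.
Qed.

End TransferBound.

Theorem lemma3p2 (R : realType) (k : nat) (hk : (2 <= k)%N) (v : 'S_k)
    (theta : R) (theta_gt0 : 0 < theta) (theta_lt1 : theta < 1) :
  exists kappa r0 : R,
    [/\ 0 < kappa < 1, 0 < r0,
        (forall z : R[i], Normc.normc z <= r0 ->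
           bounded_operator theta kappa (transfer v z))
      & exists kappa' r0' : R,
          [/\ 0 < kappa' <= kappa, 1 <= r0',
              (forall z : R[i], Normc.normc z <= r0' ->
                 bounded_operator theta kappa' (transfer v z))
            & bounded_operator theta kappa' (transfer v (1 : R[i]))]].
Proof.
have t01 : 0 < theta <= 1 by rewrite theta_gt0 ltW.
have k0 : 0 < 2^-1 :> R by rewrite invr_gt0.
have bT (z : R[i]) := transfer_bounded v t01 k0 (lexx _) z.
(* [bT] holds for every [z], with [kappa = 1/2]. The radius 1 satisfies both [0 < r0] and
   [1 <= r0'], so one pair serves both clauses. *)
exists 2^-1, 1; split=> //; first by rewrite k0 invf_lt1 ?ltr1n.
by exists 2^-1, 1; split; rewrite ?k0 ?lexx.
Qed.
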